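(* Every two-edge connected $P_6$-free finite simple graph, except for the cycle $C_5$, is either all-round or bipartite all-round.
   Context: For a graph $G=(V,E)$ and $f\colon V\to\{0,1,2,3\}$, a connected mod-4 $f$-factor is a vector $\mathbf{x}\in\{0,1,2,3\}^E$ with $\sum_{e\in\delta(v)}x_e\equiv f(v)\pmod 4$ for all $v\in V$ ($\delta(v)$ = edges incident to $v$) such that the graph $(V,\{e\in E\mid x_e>0\})$ is connected. $G$ is all-round if it has a connected mod-4 $f$-factor for every $f\colon V\to\{0,1,2,3\}$ with $\sum_{v\in V}f(v)$ even. A bipartite $G$ with bipartition classes $U,W$ is bipartite all-round if it has a connected mod-4 $f$-factor for every $f$ with $\sum_{v\in U}f(v)\equiv\sum_{v\in W}f(v)\pmod 4$. A graph is $P_6$-free if it has no induced subgraph isomorphic to the path on $6$ vertices. *)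

(* Defs.v *)
From mathcomp Require Import all_boot.

Set Implicit Arguments.
Unset Strict Implicit.
Unset Printing Implicit Defensive.

Record sgraph := SGraph {
  vertex :> finType;
  adj : rel vertex;
  adj_sym : symmetric adj;
  adj_irr : irreflexive adj
}.

Definition isomorphic (G H : sgraph) : Prop :=
  exists2 h : G -> H, bijective h & forall x y, adj (h x) (h y) = adj x y.

Section Induced.
Variables (G : sgraph) (S : {set G}).

Definition induced_adj : rel {x : G | x \in S} := fun x y => adj (val x) (val y).

Lemma induced_adj_sym : symmetric induced_adj.
Proof. by move=> x y; exact: adj_sym. Qed.

Lemma induced_adj_irr : irreflexive induced_adj.
Proof. by move=> x; exact: adj_irr. Qed.

Definition induced : sgraph := SGraph induced_adj_sym induced_adj_irr.
End Induced.

Section PathCycle.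
Variable n : nat.

Definition path_adj : rel 'I_n := fun i j => (i.+1 == j) || (j.+1 == i).

Lemma path_adj_sym : symmetric path_adj.
Proof. by move=> i j; exact: orbC. Qed.

Lemma path_adj_irr : irreflexive path_adj.
Proof. by move=> i; rewrite /path_adj orbb gtn_eqF. Qed.

Definition path_graph : sgraph := SGraph path_adj_sym path_adj_irr.

(* [i != j] only matters for n = 1, where [ordS] is the identity. *)
Definition cycle_adj : rel 'I_n :=
  fun i j => (i != j) && ((ordS i == j) || (ordS j == i)).

Lemma cycle_adj_sym : symmetric cycle_adj.
Proof. by move=> i j; rewrite /cycle_adj eq_sym orbC. Qed.

Lemma cycle_adj_irr : irreflexive cycle_adj.
Proof. by move=> i; rewrite /cycle_adj eqxx. Qed.

Definition cycle_graph : sgraph := SGraph cycle_adj_sym cycle_adj_irr.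
End PathCycle.

Definition path_free (n : nat) (G : sgraph) : Prop :=
  forall S : {set G}, ~ isomorphic (induced S) (path_graph n).

Definition connected_rel (T : finType) (e : rel T) : Prop :=
  0 < #|T| /\ forall x y, connect e x y.

Definition edge_set (G : sgraph) : {set {set G}} :=
  [set [set p.1; p.2] | p : G * G & adj p.1 p.2].

Definition edge (G : sgraph) : finType := {a : {set G} | a \in edge_set G}.

(* The one-vertex graph, which has no edge to delete, qualifies. *)
Definition two_edge_connected (G : sgraph) : Prop :=
  connected_rel (@adj G) /\
  forall a : edge G, connected_rel [rel u v : G | adj u v && ([set u; v] != val a)].

Definition support_rel (G : sgraph) (x : {ffun edge G -> 'I_4}) : rel G :=
  fun u v => [exists a : edge G, (val a == [set u; v]) && (0 < x a)].

Definition connected_mod4_factor (G : sgraph) (f : G -> 'I_4)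
    (x : {ffun edge G -> 'I_4}) : Prop :=
  (forall v : G, \sum_(a : edge G | v \in val a) x a = f v %[mod 4]) /\
  connected_rel (support_rel x).

Definition all_round (G : sgraph) : Prop :=
  forall f : G -> 'I_4, ~~ odd (\sum_(v : G) f v) ->
    exists x, connected_mod4_factor f x.

(* The classes may be empty. *)
Definition bipartition (G : sgraph) (U W : {set G}) : Prop :=
  [/\ U :|: W = [set: G], [disjoint U & W]
    & forall u v : G, adj u v -> (u \in U) = (v \in W)].

Definition bipartite_all_round (G : sgraph) : Prop :=
  exists U W : {set G}, bipartition U W /\
    forall f : G -> 'I_4,
      \sum_(v in U) f v = \sum_(v in W) f v %[mod 4] ->
      exists x, connected_mod4_factor f x.

(* Main.v *)
Require Import Defs.
From mathcomp Require Import all_boot.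
From mathcomp Require Import all_algebra ring.
From Stdlib Require Import Classical.

(* Grow a vertex set S whose demands can all be met by a connected vector, by
   attaching ears. Along an ear with k inner vertices the first edge value t
   determines the others as +-t + const, so each of the k + 1 edges vanishes for
   exactly one of the four t; for k <= 6 some t makes at most one edge vanish, and
   then every inner vertex stays attached to S. In a P6-free graph a shortest ear
   has at most five inner vertices, since these induce a path.

   If some S is all-round, growing it shows that G is all-round; if G is
   bipartite, growing a single vertex shows that G is bipartite all-round.
   Otherwise G has no triangle, and comparing breadth-first levels in a
   nonbipartite P6-free graph yields a C5. A vertex with two neighbours on the C5
   creates a C4 with an odd ear of two inner vertices, hence an all-round part. An
   edge leaving a vertex attached to the C5 creates either an induced P6 or a C6
   with an odd ear of one inner vertex. So G = C5. *)

Set Implicit Arguments.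
Unset Strict Implicit.
Unset Printing Implicit Defensive.

Import GRing.Theory.
Local Open Scope ring_scope.

(** * Attaching ears *)

Section WeightedAllRound.
Variable G : sgraph.
Implicit Types (S : {set G}) (f w : G -> 'Z_4) (X : {set G} -> 'Z_4)
  (a b u v : G) (vs : seq G) (t : 'Z_4).

Definition supp X : rel G := fun u v => X [set u; v] != 0.

Lemma supp_sym X : symmetric (supp X).
Proof. by move=> u v; rewrite /supp setUC. Qed.

Definition degree X v := \sum_(s : {set G} | v \in s) X s.

(** [X] is defined on all vertex sets, so that vectors for different [S] can be added; the first
    clause confines its support to edges inside [S]. *)
Definition solves S f X :=
  [/\ forall s, X s != 0 -> (s \in edge_set G) && (s \subset S),
      forall v, v \in S -> degree X v = f v
    & forall u v, u \in S -> v \in S -> connect (supp X) u v].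

(* The weight [fun=> 2] encodes the parity condition of all-roundness (2 n = 0
   mod 4 iff n is even); weights 1 and -1 on two colour classes encode the
   balance condition of bipartite all-roundness. *)
Definition solvable w S :=
  forall f, \sum_(v in S) w v * f v = 0 -> exists X, solves S f X.

(* On an ear [a, v1, .., vk, b], the value [t] of the first edge and the demands
   [f v1, .., f vk] force the values of the remaining edges. *)
Fixpoint ear_vals f vs t : seq 'Z_4 :=
  t :: if vs is v :: vs' then ear_vals f vs' (f v - t) else [::].

Definition ear_end f vs t := foldl (fun t v => f v - t) t vs.

Fixpoint ear_flow f a p t : {set G} -> 'Z_4 := fun s =>
  if p is v :: p' then
    (if s == [set a; v] then t else 0) + ear_flow f v p' (f v - t) s
  else 0.

Lemma edge_set2 u v : adj u v -> [set u; v] \in edge_set G.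
Proof. by move=> uv; apply/imsetP; exists (u, v); rewrite ?inE. Qed.

Lemma adj_neq u v : adj u v -> u != v.
Proof. by apply: contraTneq => ->; rewrite adj_irr. Qed.

Lemma degree_edge a v t u : a != v ->
  \sum_(s : {set G} | u \in s) (if s == [set a; v] then t else 0)
  = t *+ (u == a) + t *+ (u == v).
Proof.
move=> av; rewrite -big_mkcondr /=.
case: (boolP (u \in [set a; v])) => uav.
  rewrite (big_pred1 [set a; v]) => [|s].
    move: uav; rewrite !inE; case: (eqVneq u a) => [->|_] /=.
      by rewrite (negPf av) addr0.
    by move=> ->; rewrite add0r.
  by rewrite /=; case: eqP => [->|]; rewrite ?uav ?andbF.
rewrite big_pred0 => [|s].
  by move: uav; rewrite !inE negb_or => /andP[/negPf-> /negPf->]; rewrite addr0.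
by case: eqP => [->|]; rewrite ?(negPf uav) ?andbF.
Qed.

(** Each visit to an inner vertex [v] collects some [t] from one edge and [f v - t] from the next,
    hence [f v] in total. *)
Lemma degree_ear f a vs b t u : path (@adj G) a (rcons vs b) ->
  degree (ear_flow f a (rcons vs b) t) u =
  t *+ (u == a) + ear_end f vs t *+ (u == b) + \sum_(v <- vs) f v *+ (u == v).
Proof.
elim: vs a t => [|v vs IH] a t /= /andP[av pth]; rewrite /degree big_split /=.
  by rewrite big_nil [X in _ + X]big1_eq !addr0 degree_edge ?adj_neq.
rewrite degree_edge ?adj_neq // [X in _ + X]IH // big_cons /ear_end /= mulrnBl.
by rewrite -!addrA; congr (_ + _); rewrite addrCA addNKr addrCA.
Qed.


(** Since [t |-> f v - t] permutes Z/4, each entry of [ear_vals f vs t] vanishes for exactly one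
    [t]. *)
Lemma sum_zeros_ear f vs :
  (\sum_(t : 'Z_4) count_mem 0%R (ear_vals f vs t) = (size vs).+1)%N.
Proof.
elim: vs => [|v vs IH] /=; rewrite big_split /=.
  by rewrite !big_ord_recl !big_ord0.
rewrite [X in (_ + X)%N](reindex_inj (inj_comp (addrI (f v)) oppr_inj)) /=.
under [X in (_ + X)%N]eq_bigr do rewrite opprD opprK addNKr.
by rewrite IH !big_ord_recl !big_ord0.
Qed.

(** By averaging: two zeros for every [t] in [A] would exceed the total number of zeros. *)
Lemma few_zeros_ear f vs (A : {set 'Z_4}) : ((size vs).+1 < 2 * #|A|)%N ->
  exists2 t, t \in A & (count_mem 0%R (ear_vals f vs t) <= 1)%N.
Proof.
move=> ltA; apply/exists_inP; apply: contraLR ltA => /exists_inPn bad.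
rewrite -leqNgt -(sum_zeros_ear f vs) mulnC -sum_nat_const.
rewrite [leqRHS](bigID (mem A)) /= -[leqLHS]addn0 leq_add //.
by apply: leq_sum => t /bad; rewrite -ltnNge.
Qed.

(** * Edges of an ear and connectivity along it *)

Definition pairs a p : seq {set G} := pairmap (fun u v => [set u; v]) a p.

Lemma ear_flow0 f a p t s : s \notin pairs a p -> ear_flow f a p t s = 0.
Proof.
elim: p a t => [|v p IH] a t //=; rewrite inE negb_or => /andP[/negPf-> sNp].
by rewrite add0r IH.
Qed.

Lemma pairs_sub a p s v : s \in pairs a p -> v \in s -> v \in a :: p.
Proof.
elim: p a => [|u p IH] a //=; rewrite inE => /orP[/eqP->|su vs].
  by rewrite !inE => /orP[]/eqP->; rewrite eqxx ?orbT.
by rewrite inE (IH u su vs) orbT.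
Qed.

Lemma pairs_edge a p s : path (@adj G) a p -> s \in pairs a p -> s \in edge_set G.
Proof.
elim: p a => [|v p IH] a //= /andP[av pth]; rewrite inE => /orP[/eqP->|].
  exact: edge_set2.
exact: IH.
Qed.

Lemma pairs_meet a vs b s : vs != [::] ->
  s \in pairs a (rcons vs b) -> exists2 v, v \in vs & v \in s.
Proof.
case: vs => // v vs _; elim: vs a v => [|u vs IH] a v /=.
  by rewrite !inE => /orP[]/eqP->; exists v; rewrite !inE eqxx ?orbT.
rewrite inE => /orP[/eqP->|/IH[x xvs xs]].
  by exists v; rewrite !inE eqxx ?orbT.
by exists x => //; rewrite inE xvs orbT.
Qed.

Lemma uniq_pairs_path a p : uniq (a :: p) -> uniq (pairs a p).
Proof.
elim: p a => [|v p IH] a //= /andP[aNp /[dup] vp /IH->]; rewrite andbT.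
by apply: contra aNp => /pairs_sub; apply; rewrite !inE eqxx.
Qed.

(** This includes closed ears, [a = b]: the first edge could only recur by going straight back,
    which [head b vs != a] forbids. *)
Lemma uniq_pairs a v vs b : a \notin v :: vs -> uniq (rcons (v :: vs) b) ->
  head b vs != a -> uniq (pairs a (rcons (v :: vs) b)).
Proof.
move=> aN uvs hd /=; rewrite -/(pairs _ _) uniq_pairs_path // andbT.
case: vs aN uvs hd => [|u vs] /=; rewrite !inE ?negb_or.
  move=> av; rewrite andbT => vb ba.
  apply: contra ba => /eqP/setP/(_ b).
  by rewrite !inE eqxx orbT [b == v]eq_sym (negPf vb) orbF.
move=> /and3P[av au aN] /andP[/andP[vu vN] _] _; apply/andP; split.
  apply/eqP => /setP/(_ a); rewrite !inE eqxx (negPf av) (negPf au).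
  by [].
apply/negP => /pairs_sub sub; have := sub v.
by rewrite !inE eqxx orbT (negPf vu) (negPf vN) => /(_ isT).
Qed.

Fixpoint linked (e : rel G) a p (ts : seq 'Z_4) :=
  if p is v :: p' then ((head 0 ts != 0) ==> e a v) && linked e v p' (behead ts)
  else true.

Lemma linked_ear X f a vs b t : uniq (pairs a (rcons vs b)) ->
  {in pairs a (rcons vs b), X =1 ear_flow f a (rcons vs b) t} ->
  linked (supp X) a (rcons vs b) (ear_vals f vs t).
Proof.
elim: vs a t => [|v vs IH] a t /=.
  by move=> _ XE; rewrite /supp XE ?inE //= eqxx addr0 andbT implybb.
move=> /andP[avN uvs] XE; rewrite IH // => [|s sp].
  by rewrite andbT /supp XE ?inE ?eqxx // ear_flow0 // addr0 implybb.
rewrite XE ?inE ?sp ?orbT // ifN ?add0r //.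
by apply: contraNneq avN => <-.
Qed.

Lemma linked_connect0 e a vs b f t v : linked e a (rcons vs b) (ear_vals f vs t) ->
  0 \notin ear_vals f vs t -> v \in rcons vs b -> connect e a v.
Proof.
elim: vs a t => [|u vs IH] a t /=; rewrite !inE.
  by rewrite andbT eq_sym => /implyP eab /eab ab /eqP->; exact: connect1.
rewrite negb_or eq_sym => /andP[/implyP eau lk] /andP[/eau{}eau Nvs].
case/orP => [/eqP->|vv]; first exact: connect1.
exact: connect_trans (connect1 eau) (IH _ _ lk Nvs vv).
Qed.

(** One zero cuts the ear into two pieces, one hanging on [a] and the other on [b]. *)
Lemma linked_connect e a vs b f t v : symmetric e ->
  linked e a (rcons vs b) (ear_vals f vs t) ->
  (count_mem 0%R (ear_vals f vs t) <= 1)%N -> v \in vs ->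
  connect e a v \/ connect e b v.
Proof.
move=> esym; elim: vs a t => [|u vs IH] a t //= /andP[eau lk].
case: (eqVneq t 0) => [->|t0] in eau lk *.
  (* The first edge is the only zero, so the rest of the ear is intact and hangs on [b]. *)
  rewrite add1n ltnS leqn0 -/(count_mem _ _) => /eqP cnt vv; right.
  have N0 : 0 \notin ear_vals f vs (f u - 0) by apply/count_memPn.
  have uall (x : G) : x \in rcons vs b -> connect e u x by exact: linked_connect0 lk N0.
  have bu : connect e b u.
    by rewrite (sym_connect_sym esym) uall // mem_rcons inE eqxx.
  move: vv; rewrite inE => /orP[/eqP->//|vv].
  by apply: connect_trans bu (uall _ _); rewrite mem_rcons inE vv orbT.
rewrite add0n inE => cnt /orP[/eqP->|vv]; first by left; exact: connect1.
case: (IH _ _ lk cnt vv) => [uv|]; last by right.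
by left; apply: connect_trans (connect1 _) uv.
Qed.

(** A closed ear with one inner vertex would use an edge twice; an ear without inner vertices would
    not enlarge [S]. *)
Definition is_ear S a vs b :=
  [&& [&& a \in S, b \in S & all [predC S] vs], path (@adj G) a (rcons vs b), uniq vs,
      vs != [::] & (a == b) ==> (1 < size vs)%N].

Lemma is_ear_uniq S a vs b : is_ear S a vs b -> uniq (pairs a (rcons vs b)).
Proof.
case: vs => [|v vs]; first by case/and5P.
case/and5P=> /and3P[aS bS /allP vsS] _ uvs _ ab; have NS x : x \in S -> x \notin v :: vs.
  by move=> xS; apply/negP => /vsS; rewrite /= xS.
apply: uniq_pairs; rewrite ?NS // ?rcons_uniq ?uvs ?NS //.
case: vs {uvs} vsS ab {NS} => [|u vs] vsS /=; first by rewrite eq_sym; case: eqP.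
by move=> _; apply: contraTneq aS => <-; apply: vsS; rewrite !inE eqxx orbT.
Qed.

(** [X] meets what the end edges of the ear leave of the demands at [a] and [b]. Every ear edge
    contains an inner vertex, so [X] vanishes on it and the two vectors do not interfere. *)
Lemma solves_ear S f a vs b t X : is_ear S a vs b ->
  (count_mem 0%R (ear_vals f vs t) <= 1)%N ->
  solves S (fun v => f v - t *+ (v == a) - ear_end f vs t *+ (v == b)) X ->
  solves (S :|: [set x in vs]) f (fun s => X s + ear_flow f a (rcons vs b) t s).
Proof.
move=> ear cnt [Xsub Xdeg Xcon]; have upairs := is_ear_uniq ear.
case/and5P: ear => /and3P[aS bS /allP vsS] pth uvs vs0 _.
set Y := ear_flow _ _ _ _.
have YS s : s \in pairs a (rcons vs b) -> X s = 0.
  move=> sp; apply: contraTeq isT => /Xsub/andP[_ /subsetP sS].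
  have [u /vsS /= uS us] := pairs_meet vs0 sp.
  by rewrite sS in uS.
have suppXY u v : supp X u v -> supp (fun s => X s + Y s) u v.
  rewrite /supp => XN0; rewrite /Y ear_flow0 ?addr0 //.
  by apply: contraNN XN0 => /YS->.
have conXY u v : u \in S -> v \in S -> connect (supp (fun s => X s + Y s)) u v.
  move=> uS vS; apply: connect_sub (Xcon u v uS vS) => x y /suppXY.
  exact: connect1.
have con_sym : connect_sym (supp (fun s => X s + Y s)).
  by apply: sym_connect_sym => x y; rewrite supp_sym.
split.
- move=> s; case: (boolP (s \in pairs a (rcons vs b))) => [sp _|sNp].
    rewrite (pairs_edge pth sp); apply/subsetP => x /(pairs_sub sp).
    by rewrite !inE mem_rcons !inE => /or3P[/eqP->|/eqP->|->]; rewrite ?aS ?bS ?orbT.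
  rewrite /Y ear_flow0 // addr0 => /Xsub/andP[-> /= sS].
  exact: subset_trans sS (subsetUl _ _).
- move=> v vS'; rewrite /degree big_split /= -![\sum_(s : {set G} | _) _]/(degree _ _).
  rewrite degree_ear //.
  case: (boolP (v \in S)) => [vS|vNS].
    rewrite Xdeg // [X in _ + X = _]addrC big_seq big1 => [|u uvs'].
      by rewrite add0r [X in _ + X = _]addrC addrA !subrK.
    by case: eqP => // vu; move: (vsS _ uvs'); rewrite /= -vu vS.
  have vvs : v \in vs by move: vS'; rewrite !inE (negPf vNS).
  have [va vb] : v != a /\ v != b by split; apply: contraNneq vNS => ->.
  rewrite {1}/degree big1 => [|s vs']; last first.
    by apply: contraNeq vNS => /Xsub/andP[_ /subsetP]; apply.
  rewrite (negPf va) (negPf vb) !mulr0n !add0r (bigD1_seq v) //= eqxx.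
  by rewrite big1 ?addr0 // => u /negPf; rewrite eq_sym => ->.
- have acon v : v \in S :|: [set x in vs] -> connect (supp (fun s => X s + Y s)) a v.
    rewrite !inE => /orP[/(conXY _ _ aS)//|vvs].
    have lk : linked (supp (fun s => X s + Y s)) a (rcons vs b) (ear_vals f vs t).
      by apply: linked_ear => // s /YS->; rewrite add0r.
    have [//|bv] := linked_connect (supp_sym _) lk cnt vvs.
    exact: connect_trans (conXY _ _ aS bS) bv.
  by move=> u v /acon au /acon; apply: connect_trans; rewrite con_sym.
Qed.

(** If [u] precedes [v], then [w v * f v = w v * (f v - t) - w u * t], so the sum telescopes. *)
Lemma ear_weight w f a vs t : path (fun u v => w v == - w u) a vs ->
  \sum_(v <- vs) w v * f v = w (last a vs) * ear_end f vs t - w a * t.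
Proof.
elim: vs a t => [|v vs IH] a t /=; first by rewrite big_nil subrr.
case/andP=> /eqP wv /(IH v (f v - t)); rewrite big_cons => ->.
by rewrite wv /ear_end /=; ring.
Qed.

Lemma sum_residual w S f a b t t' : a \in S -> b \in S ->
  \sum_(v in S) w v * (f v - t *+ (v == a) - t' *+ (v == b)) =
  \sum_(v in S) w v * f v - w a * t - w b * t'.
Proof.
have sum1 c r : c \in S -> \sum_(v in S) w v * (r *+ (v == c)) = w c * r.
  move=> cS; rewrite (bigD1 c) //= eqxx big1 ?addr0 // => v /andP[_ /negPf->].
  by rewrite mulr0.
move=> aS bS; under eq_bigr do rewrite !mulrBr.
by rewrite !sumrB !sum1.
Qed.

Lemma sum_ear_set S f vs : all [predC S] vs -> uniq vs ->
  \sum_(v in S :|: [set x in vs]) f v = \sum_(v in S) f v + \sum_(v <- vs) f v.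
Proof.
move=> /allP vsS uvs; rewrite (eq_bigl [predU S & vs]) => [|v]; last by rewrite !inE.
rewrite bigU /=; first by rewrite [in RHS]big_uniq.
rewrite disjoint_sym disjoint_subset; apply/subsetP => v /vsS.
by rewrite inE.
Qed.

(* The condition on [w] also holds for the constant weight 2, because 2 = - 2
   in Z/4, so the lemma covers arbitrary ears attached to an all-round part. *)
Lemma solvable_ear w S a vs b : solvable w S -> is_ear S a vs b ->
  path (fun u v => w v == - w u) a (rcons vs b) -> (size vs <= 6)%N ->
  solvable w (S :|: [set x in vs]).
Proof.
move=> solS ear pw szvs f f0.
(* All four values of [t] are candidates, which suffices when [(size vs).+1 < 8]; hence the bound
   6. *)
have [|t _ cnt] := few_zeros_ear f (vs := vs) (A := setT).
  by rewrite cardsT card_ord.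
case/and5P: (ear) => /and3P[aS bS vsS] _ uvs _ _.
suff [X solX] : exists X, solves S (fun v => f v - t *+ (v == a)
    - ear_end f vs t *+ (v == b)) X.
  by eexists; exact: solves_ear ear cnt solX.
(* As [w b = - w (last a vs)], the residual balance on [S] equals the balance on the enlarged set,
   whatever [t] is. *)
apply: solS; rewrite sum_residual //; move: pw; rewrite rcons_path => /andP[pw /eqP wb].
move: f0; rewrite sum_ear_set // (ear_weight _ t pw) => f0.
by rewrite wb mulNr opprK addrAC -addrA.
Qed.

(** Either [x = 0], with halves 0 and 2, or [x = 2], with halves 1 and 3. *)
Lemma Z4_half (x : 'Z_4) : 2 * x = 0 -> #|[set t : 'Z_4 | 2 * t == x]| = 2%N.
Proof.
move=> x2; rewrite -sum1dep_card.
case: x x2 => -[|[|[|[|//]]]] /= lx /eqP; rewrite //= => _;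
by rewrite big_mkcond /= !big_ord_recl big_ord0 /=.
Qed.

(* The ear closes an odd cycle: balance on [S] then only fixes the parity of the
   first edge value, which leaves two candidates. *)
Lemma solvable_odd_ear w S a vs b : (forall v, w v = 1 \/ w v = -1) ->
  solvable w S -> is_ear S a vs b ->
  path (fun u v => w v == - w u) a vs -> w b = w (last a vs) -> (size vs <= 2)%N ->
  solvable (fun=> 2) (S :|: [set x in vs]).
Proof.
move=> w1 solS ear pw wb szvs f f0.
have w2 v : 2 * w v = 2 by case: (w1 v) => ->; apply/eqP.
case/and5P: (ear) => /and3P[aS bS vsS] _ uvs _ _.
(* Since [w b = w (last a vs)] and [2 * w a = 2], the residual balance is this right-hand side minus
   [2 * t]. Its two roots suffice when [(size vs).+1 < 4]. *)
have [|t] := few_zeros_ear f (vs := vs)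
    (A := [set t | 2 * t == \sum_(v in S) w v * f v - \sum_(v <- vs) w v * f v]).
  rewrite Z4_half ?ltnS //.
  have m2 (x : 'Z_4) : 2 * - x = 2 * x by rewrite mulrN -mulNr; congr (_ * _); apply/eqP.
  rewrite mulrDr m2 !mulr_sumr -[RHS]f0 sum_ear_set //.
  by congr (_ + _); apply: eq_bigr => v _; rewrite mulrA w2.
rewrite inE => /eqP t2 cnt.
suff [X solX] : exists X, solves S (fun v => f v - t *+ (v == a)
    - ear_end f vs t *+ (v == b)) X.
  by eexists; exact: solves_ear ear cnt solX.
apply: solS; rewrite sum_residual // wb.
have -> : \sum_(v in S) w v * f v = 2 * t + \sum_(v <- vs) w v * f v.
  by rewrite t2 subrK.
rewrite -(w2 a) (ear_weight _ t pw); ring.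
Qed.

(** As [w v] is a unit, balance forces [f v = 0], met by the zero vector. This is the seed to which
    ears are attached. *)
Lemma solvable1 w v : w v * w v = 1 -> solvable w [set v].
Proof.
move=> w1 f; rewrite big_set1 => wf; exists (fun=> 0); split.
- by move=> s; rewrite eqxx.
- move=> u; rewrite inE => /eqP->; rewrite /degree big1 //.
  by rewrite -[f v]mul1r -w1 -mulrA wf mulr0.
- by move=> x y; rewrite !inE => /eqP-> /eqP->.
Qed.

End WeightedAllRound.

(** * Short ears in P6-free graphs *)

Lemma path6_chord (G : sgraph) (v1 v2 v3 v4 v5 v6 : G) : path_free 6 G ->
  adj v1 v2 -> adj v2 v3 -> adj v3 v4 -> adj v4 v5 -> adj v5 v6 ->
  [|| adj v1 v3, adj v1 v4, adj v1 v5, adj v1 v6, adj v2 v4, adj v2 v5,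
      adj v2 v6, adj v3 v5, adj v3 v6 | adj v4 v6].
Proof.
move=> P6 a12 a23 a34 a45 a56; apply: contraT; rewrite !negb_or.
move=> /and5P[/negPf n13 /negPf n14 /negPf n15 /negPf n16 /and5P[/negPf n24 /negPf n25 /negPf n26 /negPf n35 /andP[/negPf n36 /negPf n46]]].
pose g (i : 'I_6) := nth v1 [:: v1; v2; v3; v4; v5; v6] i.
have gE i j : adj (g i) (g j) = path_adj i j.
  move: i j => [[|[|[|[|[|[|//]]]]]] ?] [[|[|[|[|[|[|//]]]]]] ?]; rewrite /g /=;
    by rewrite ?adj_irr // 1?adj_sym.
(* No two vertices of the path on six vertices have the same neighbours, so the adjacencies alone
   make [g] injective. *)
have g_inj : injective g.
  move=> i j gij; apply/eqP; have /forallP : [forall k, path_adj i k == path_adj j k].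
    by apply/forallP => k; rewrite -!gE gij.
  move: i j {gij} => [[|[|[|[|[|[|//]]]]]] ?] [[|[|[|[|[|[|//]]]]]] ?] // ij;
  by move: (ij (inord 0)) (ij (inord 1)) (ij (inord 2)) (ij (inord 3))
     (ij (inord 4)) (ij (inord 5)); rewrite /path_adj !inordK.
pose S := [set g i | i in 'I_6].
have gS i : g i \in S by exact: imset_f.
pose h i : induced S := exist _ (g i) (gS i).
have [h' hK h'K] : bijective h.
  apply: inj_card_bij => [i j [/g_inj]//|].
  by rewrite card_sig -/(#|S|) card_imset.
case: (P6 S); exists h' => [|x y]; first by exists h.
by rewrite -[x in RHS]h'K -[y in RHS]h'K /= /induced_adj /= gE.
Qed.

Lemma connect_exit (T : finType) (e : rel T) (S : {set T}) x y :
  connect e x y -> x \in S -> y \notin S ->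
  exists u v, [/\ e u v, u \in S & v \notin S].
Proof.
case/connectP => p pth ->; elim: p x pth => [|z p IH] x /=; first by move=> _ ->.
case/andP=> xz pth xS lNS; case: (boolP (z \in S)) => zS; first exact: IH zS lNS.
by exists x, z.
Qed.

Lemma path_first_entry (T : finType) (e : rel T) (S : {set T}) v p :
  path e v p -> v \notin S -> last v p \in S ->
  exists vs b, [/\ path e v (rcons vs b), all [predC S] vs, b \in S
    & subseq (rcons vs b) p].
Proof.
elim: p v => [|z p IH] v /=; first by move=> _ /negPf->.
case/andP=> vz pth vNS lS; case: (boolP (z \in S)) => zS.
  by exists [::], z; rewrite /= eqxx sub0seq vz.
have [vs [b [pvs allvs bS sub]]] := IH _ pth zS lS.
by exists (z :: vs), b; rewrite /= eqxx vz pvs zS.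
Qed.

(** Leave [S] by an edge from [a] to [v], delete that edge, and follow a path from [v] towards [a]
    until it first meets [S]. *)
Lemma two_edge_connected_ear (G : sgraph) (S : {set G}) x y :
  two_edge_connected G -> x \in S -> y \notin S -> exists a vs b, is_ear S a vs b.
Proof.
move=> [[_ conG] conD] xS yS; have [a [v [av aS vNS]]] := connect_exit (conG x y) xS yS.
have [_ /(_ v a)/connectP[p pth la]] := conD (exist _ [set a; v] (edge_set2 av)).
case/shortenP: pth la => p' pth up _ la {p}.
have [|vs [b [pvs Nvs bS sub]]] := path_first_entry pth vNS.
  by rewrite -la.
have uvs : uniq (v :: rcons vs b).
  by apply: subseq_uniq up; rewrite /= eqxx.
exists a, (v :: vs), b; apply/and5P; split => //=.
- by rewrite aS bS vNS.
- by rewrite av /=; apply: sub_path pvs => c d /andP[].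
- by move: uvs; rewrite /= mem_rcons inE negb_or rcons_uniq => /andP[/andP[_ ->] /andP[]].
(* With [v] as the only inner vertex, [b = a] would reuse the deleted edge. *)
- case: vs pvs {Nvs sub uvs} => [|u vs _]; last by rewrite ltnS implybT.
  rewrite /= andbT => /andP[_]; rewrite setUC; apply: contraNneq => ->.
  by rewrite eqxx.
Qed.

(** Both ends of the chord remain inner vertices, so even a closed ear stays long enough. *)
Lemma is_ear_cut (G : sgraph) (S : {set G}) a s1 x s2 y s3 b :
  is_ear S a (s1 ++ x :: s2 ++ y :: s3) b -> adj x y ->
  is_ear S a (s1 ++ x :: y :: s3) b.
Proof.
case/and5P => /and3P[aS bS vsS] pth uvs _ _ xy; apply/and5P; split.
- rewrite aS bS; move: vsS; rewrite !all_cat /= !all_cat /=.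
  by case/and5P => -> -> _ -> ->.
- move: pth; rewrite !rcons_cat /= !rcons_cat !cat_path /= !cat_path /= xy.
  by case/and5P => -> -> _ _ ->.
- apply: subseq_uniq uvs; apply: cat_subseq => //=; rewrite eqxx.
  exact: suffix_subseq.
- by case: s1 {pth vsS uvs}.
- by rewrite size_cat /= !addnS !ltnS implybT.
Qed.

(** While there are at least six inner vertices, the first six have a chord, which shortcuts the
    ear. *)
Lemma short_ear (G : sgraph) (S : {set G}) x y :
  two_edge_connected G -> path_free 6 G -> x \in S -> y \notin S ->
  exists a vs b, is_ear S a vs b /\ (size vs <= 5)%N.
Proof.
move=> G2 P6 xS yS; have [a [vs [b]]] := two_edge_connected_ear G2 xS yS.
elim: {vs}_.+1 {-2}vs (ltnSn (size vs)) => // n IH vs; rewrite ltnS => szvs ear.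
case: (leqP (size vs) 5) => [le5|]; first by exists a, vs, b.
case: vs => [|v1 [|v2 [|v3 [|v4 [|v5 [|v6 r]]]]]] // in szvs ear * => _.
have cut s1 u s2 v s3 : [:: v1, v2, v3, v4, v5, v6 & r] = s1 ++ u :: s2 ++ v :: s3 ->
    s2 != [::] -> adj u v -> exists a vs b, is_ear S a vs b /\ (size vs <= 5)%N.
  move=> vsE s20 uv; rewrite vsE in szvs ear; apply: IH (is_ear_cut ear uv).
  apply: leq_trans szvs; rewrite !size_cat /= !size_cat /= ltn_add2l !ltnS.
  by rewrite -[leqLHS]add1n leq_add2r lt0n size_eq0.
case/and5P: ear => _ /= /andP[_ /and5P[a12 a23 a34 a45 /andP[a56 _]]] _ _ _.
case/orP: (path6_chord P6 a12 a23 a34 a45 a56) => [|].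
  exact: (cut [::] _ [:: v2] _ _ erefl).
case/orP; first exact: (cut [::] _ [:: v2; v3] _ _ erefl).
case/orP; first exact: (cut [::] _ [:: v2; v3; v4] _ _ erefl).
case/orP; first exact: (cut [::] _ [:: v2; v3; v4; v5] _ _ erefl).
case/orP; first exact: (cut [:: v1] _ [:: v3] _ _ erefl).
case/orP; first exact: (cut [:: v1] _ [:: v3; v4] _ _ erefl).
case/orP; first exact: (cut [:: v1] _ [:: v3; v4; v5] _ _ erefl).
case/orP; first exact: (cut [:: v1; v2] _ [:: v4] _ _ erefl).
case/orP; first exact: (cut [:: v1; v2] _ [:: v4; v5] _ _ erefl).
exact: (cut [:: v1; v2; v3] _ [:: v5] _ _ erefl).
Qed.

(** Alternation holds for the weight 2, as 2 = -2, and for the signs of a proper 2-colouring. Each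
    ear shrinks the complement of [S]. *)
Lemma solvable_grow (G : sgraph) (w : G -> 'Z_4) (S : {set G}) x :
  two_edge_connected G -> path_free 6 G ->
  (forall u v, adj u v -> w v = - w u) ->
  x \in S -> solvable w S -> solvable w [set: G].
Proof.
move=> G2 P6 walt; elim: {S}_.+1 {-2}S (ltnSn #|~: S|) => // n IH S; rewrite ltnS.
move=> szS xS solS; case: (set_0Vmem (~: S)) => [S0|[y]].
  by rewrite -setC0 -S0 setCK.
rewrite inE => yS; have [a [vs [b [ear le5]]]] := short_ear G2 P6 xS yS.
apply: (IH (S :|: [set v in vs])); last 2 first.
- by rewrite inE xS.
- apply: (solvable_ear solS ear) (leq_trans le5 _) => //.
  by case/and5P: ear => _ pth _ _ _; apply: sub_path pth => u v /walt/eqP.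
apply: leq_trans szS; apply: proper_card; rewrite setCU properE subsetIl /=.
apply/subsetPn; case/and5P: ear => /and3P[_ _ vsS] _ _ vs0 _.
case: vs vs0 vsS {le5} => //= v vs _ /andP[vS _].
by exists v; rewrite !inE ?eqxx ?andbF.
Qed.

(** * From solvability to connected mod-4 factors *)

Lemma eqn_mod4 m n : m%:R = n%:R :> 'Z_4 -> m = n %[mod 4].
Proof. by move/(congr1 (@nat_of_ord _)); rewrite !val_Zp_nat. Qed.

Lemma solves_factor (G : sgraph) (f : G -> 'I_4) X (v0 : G) :
  solves [set: G] (f : G -> 'Z_4) X -> exists x, connected_mod4_factor f x.
Proof.
move=> [Xsub Xdeg Xcon]; exists [ffun a => X (val a)]; split.
  move=> v; apply: eqn_mod4; rewrite natr_sum.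
  under eq_bigr do rewrite ffunE [_%:R]natr_Zp.
  rewrite [RHS](natr_Zp (f v : 'Z_4)) -Xdeg ?inE // /degree.
  rewrite [RHS](bigID (mem (edge_set G))) /= [X in _ = _ + X]big1 ?addr0 => [|s].
    by rewrite (eq_bigl _ _ (fun s => andbC _ _)) big_sub_cond.
  by case/andP=> _; apply: contraNeq => /Xsub/andP[].
split; first by apply/card_gt0P; exists v0.
move=> u v; apply: connect_sub (Xcon u v (in_setT _) (in_setT _)) => x y xy.
apply/connect1/existsP; have /andP[xyE _] := Xsub _ xy.
exists (exist (fun s => s \in edge_set G) _ xyE); rewrite eqxx ffunE /= lt0n.
by apply: contraNneq xy => x0; apply/eqP/val_inj.
Qed.

Lemma solvable_all_round (G : sgraph) (v0 : G) :
  solvable (fun=> 2) [set: G] -> all_round G.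
Proof.
move=> sol f fev; have [|X solX] := sol f; last exact: (solves_factor v0 solX).
rewrite -mulr_sumr.
under eq_bigr do rewrite -[f _ : 'Z_4]natr_Zp.
rewrite (eq_bigl predT) => [|v]; last by rewrite inE.
rewrite -natr_sum -natrM.
move: (\sum_v _)%N fev => m; rewrite -[m in (_ * m)%N]odd_double_half => /negPf->.
by rewrite add0n -muln2 mulnCA natrM [X in _ * X](@pchar_Zp 4) ?mulr0.
Qed.

Definition sign (T : Type) (c : pred T) (v : T) : 'Z_4 := if c v then 1 else -1.

Lemma solvable_bipartite_all_round (G : sgraph) (v0 : G) (c : pred G) :
  (forall u v, adj u v -> c u != c v) ->
  solvable (sign c) [set: G] -> bipartite_all_round G.
Proof.
move=> cP sol; exists [set v | c v], [set v | ~~ c v]; split.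
  split.
  - by apply/setP => v; rewrite !inE orbN.
  - by rewrite disjoint_subset; apply/subsetP => v; rewrite !inE negbK.
  - by move=> u v /cP; rewrite !inE; case: (c u); case: (c v).
move=> f fUW; have [|X solX] := sol f; last exact: (solves_factor v0 solX).
rewrite (bigID c) /=.
have sumN (P : pred G) : \sum_(v in [set v | P v]) (f v : 'Z_4) =
    (\sum_(v in [set v | P v]) f v)%:R.
  by rewrite natr_sum; apply: eq_bigr => v _; rewrite [RHS]natr_Zp.
transitivity ((\sum_(v in [set v | c v]) f v)%:R - (\sum_(v in [set v | ~~ c v]) f v)%:R : 'Z_4).
  rewrite -!sumN -sumrN; congr (_ + _); apply: eq_big => v; rewrite ?inE //= /sign.
    by move=> ->; rewrite mul1r.
  by move=> /negPf->; rewrite mulN1r.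
by apply/eqP; rewrite subr_eq0; apply/eqP/val_inj; rewrite /= !val_Zp_nat.

Qed.

(** * Breadth-first levels *)

Section Levels.
Variables (G : sgraph) (r : G).

Fixpoint reach n (v : G) : bool :=
  if n is m.+1 then [exists u, reach m u && adj u v] else v == r.

Hypothesis conG : forall u v, connect (@adj G) u v.

Lemma reach_path n u p : reach n u -> path (@adj G) u p -> reach (n + size p) (last u p).
Proof.
elim: p n u => [|v p IH] n u /=; first by rewrite addn0.
move=> ru /andP[uv pth]; rewrite addnS -addSn; apply: IH pth.
by apply/existsP; exists u; apply/andP.
Qed.

Lemma reach_ex v : exists n, reach n v.
Proof.
case/connectP: (conG r v) => p pth ->; exists (0 + size p)%N.
by apply: reach_path pth; rewrite /= eqxx.
Qed.

(** The distance from [r]: [reach n] marks the ends of walks with exactly [n] edges. *)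
Definition level v := ex_minn (reach_ex v).

Lemma level_min n v : reach n v -> (level v <= n)%N.
Proof. by rewrite /level; case: ex_minnP => m _; apply. Qed.

Lemma reach_level v : reach (level v) v.
Proof. by rewrite /level; case: ex_minnP. Qed.

Lemma level_adj u v : adj u v -> (level v <= (level u).+1)%N.
Proof.
by move=> uv; apply: level_min; apply/existsP; exists u; apply/andP; split=> //; exact: reach_level.
Qed.

Lemma level0 v : level v = 0%N -> v = r.
Proof. by move=> v0; have := reach_level v; rewrite v0 => /eqP. Qed.

Lemma level_pred v n : level v = n.+1 -> exists2 u, adj u v & level u = n.
Proof.
move=> vn; have := reach_level v; rewrite vn => /existsP[u /andP[/level_min un uv]].
by exists u => //; apply/eqP; rewrite eqn_leq un -ltnS -vn level_adj.
Qed.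

Lemma level_gap u v : ((level u).+1 < level v)%N -> adj u v = false.
Proof. by apply: contraTF => /level_adj; rewrite -leqNgt. Qed.

Hypothesis P6 : path_free 6 G.
Hypothesis triangle_free : forall x y z : G, adj x y -> adj y z -> adj x z = false.
Hypothesis pentagon_free : forall v1 v2 v3 v4 v5 : G,
  adj v1 v2 -> adj v2 v3 -> adj v3 v4 -> adj v4 v5 -> adj v5 v1 = false.

(** For an edge [u v] inside a level, take predecessors [u1], [u2], [u3] above [u] and [v1] above
    [v]: then [u3 u2 u1 u v v1] is an induced path. Near the root, coinciding predecessors give a
    contradiction instead. *)
Lemma level_indep n u v : level u = n -> level v = n -> adj u v = false.
Proof.
elim: n u v => [|n IH] u v un vn.
  by rewrite (level0 un) (level0 vn) adj_irr.
apply/negP => uv; have [u1 uu1 u1n] := level_pred un; have [v1 vv1 v1n] := level_pred vn.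
have u1v1 : u1 != v1 by apply: contraTneq uu1 => ->; rewrite adj_sym (triangle_free uv) // adj_sym.
case: n IH un vn u1n v1n => [|n] IH un vn u1n v1n.
  by rewrite (level0 u1n) (level0 v1n) eqxx in u1v1.
have [u2 u12 u2n] := level_pred u1n; have [v2 v12 v2n] := level_pred v1n.
(* Otherwise [u2 u1 u v v1] is a pentagon. *)
have v1u2 : adj u2 v1 = false.
  by rewrite adj_sym (pentagon_free u12 uu1 uv) // adj_sym.
(* If [u] and [v] have level 2, then [u2] and [v2] are both the root, so [u2] is adjacent to
   [v1]. *)
case: n IH un vn u1n v1n u2n v2n => [|n] IH un vn u1n v1n u2n v2n.
  by rewrite (level0 u2n) -(level0 v2n) v12 in v1u2.
have [u3 u23 u3n] := level_pred u2n.
have vv1' : adj v v1 by rewrite adj_sym.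
have := path6_chord P6 u23 u12 uu1 uv vv1'.
rewrite v1u2 (IH _ _ u1n v1n) (triangle_free uu1 uv) (triangle_free uv vv1').
by rewrite !level_gap // ?un ?vn ?u1n ?v1n ?u2n ?u3n.
Qed.

Lemma level_coloring u v : adj u v -> odd (level u) != odd (level v).
Proof.
move=> uv; have := level_adj uv; have := @level_adj v u; rewrite adj_sym => /(_ uv).
case: (ltngtP (level u) (level v)) => [lt _ le|lt le _|E]; last first.
- by rewrite (level_indep E erefl) in uv.
- have -> : level u = (level v).+1 by apply/eqP; rewrite eqn_leq le.
  by rewrite /=; case: odd.
- have -> : level v = (level u).+1 by apply/eqP; rewrite eqn_leq le.
  by rewrite /=; case: odd.
Qed.

End Levels.

(* From [H : uniq s], all disequalities between entries of [s], both ways. *)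
Ltac split_neqs H :=
  rewrite /= ?inE ?negb_or -?andbA ?andbT in H;
  repeat match type of H with
  | is_true (_ && _) =>
      let H1 := fresh "neq" in let H2 := fresh "neq" in
      case/andP: H => /[dup] /negPf H1; rewrite eq_sym => /negPf H2 H
  end; move: (H); rewrite eq_sym => /negPf ?; move/negPf: H => ?.

Ltac use_neqs := rewrite ?eqxx;
  repeat match goal with H : (?x == ?y) = false |- context [?x == ?y] => rewrite H end.

Ltac use_adjs :=
  repeat match goal with
  | H : is_true (adj ?x ?y) |- context [adj ?x ?y] => rewrite H
  | H : is_true (adj ?x ?y) |- context [adj ?y ?x] => rewrite (adj_sym y x) H
  end.

Ltac check_ear := rewrite /is_ear /= ?inE; use_neqs; use_adjs; rewrite /= ?implybT.

Ltac check_sign := rewrite /sign /= ?inE; use_neqs; rewrite /= ?opprK ?eqxx.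

(** * Small all-round parts: an even cycle or a vertex with an odd ear *)

Section Parts.
Variable G : sgraph.

(** The member [x] rules out the empty set, which is trivially solvable. *)
Definition all_round_part := exists (S : {set G}) x, x \in S /\ solvable (fun=> 2) S.

Lemma sign_pm1 (c : pred G) v : sign c v = 1 \/ sign c v = -1.
Proof. by rewrite /sign; case: (c v); [left | right]. Qed.

Lemma sign_sqr (c : pred G) v : sign c v * sign c v = 1.
Proof. by case: (sign_pm1 c v) => ->; rewrite ?mulrNN mulr1. Qed.

Lemma triangle_part (x y z : G) : adj x y -> adj y z -> adj z x -> all_round_part.
Proof.
move=> xy yz zx; have U : uniq [:: x; y; z].
  by rewrite /= !inE negb_or (adj_neq xy) (adj_neq yz) eq_sym (adj_neq zx).
split_neqs U.
exists ([set x] :|: [set v in [:: y; z]]), x; split; first by rewrite !inE eqxx.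
(* Signs alternate along [x y z], and the closing edge from [z] to [x] joins equal signs. *)
have sol := solvable1 (sign_sqr [pred v | v != y] x).
apply: (solvable_odd_ear (sign_pm1 _) sol (a := x) (b := x)) => //; first by check_ear.
  by check_sign.
by check_sign.
Qed.

(** The 4-cycle [c1 c2 c3 v] has [c1] and [c3] in the same colour class, so the three-edge ear
    through [c5] and [c4] is odd. *)
Lemma square_part (v c1 c2 c3 c4 c5 : G) : uniq [:: v; c1; c2; c3; c4; c5] ->
  adj c1 c2 -> adj c2 c3 -> adj c3 v -> adj v c1 -> adj c1 c5 -> adj c5 c4 ->
  adj c4 c3 -> all_round_part.
Proof.
move=> U *; split_neqs U.
exists ([set c1] :|: [set x in [:: c2; c3; v]] :|: [set x in [:: c5; c4]]), c1.
split; first by rewrite !inE eqxx.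
have := solvable1 (sign_sqr [pred x in [:: c1; c3; c4]] c1).
move=> /(solvable_ear (vs := [:: c2; c3; v]) (a := c1) (b := c1)) sol.
apply: (solvable_odd_ear (sign_pm1 _) (sol _ _ _) (a := c1) (b := c3)) => //.
- by check_ear.
- by check_sign.
- by check_ear.
- by check_sign.
- by check_sign.
Qed.

(** The 6-cycle [c1 v1 v2 c3 c4 c5] has [c1] and [c3] in opposite colour classes, so the two-edge
    ear through [c2] is odd. *)
Lemma hexagon_part (c1 c2 c3 c4 c5 v1 v2 : G) :
  uniq [:: c1; c2; c3; c4; c5; v1; v2] ->
  adj c1 v1 -> adj v1 v2 -> adj v2 c3 -> adj c3 c4 -> adj c4 c5 -> adj c5 c1 ->
  adj c1 c2 -> adj c2 c3 -> all_round_part.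
Proof.
move=> U *; split_neqs U.
exists ([set c1] :|: [set x in [:: v1; v2; c3; c4; c5]] :|: [set x in [:: c2]]), c1.
split; first by rewrite !inE eqxx.
have := solvable1 (sign_sqr [pred x in [:: c1; v2; c4]] c1).
move=> /(solvable_ear (vs := [:: v1; v2; c3; c4; c5]) (a := c1) (b := c1)) sol.
apply: (solvable_odd_ear (sign_pm1 _) (sol _ _ _) (a := c1) (b := c3)) => //.
- by check_ear.
- by check_sign.
- by check_ear.
- by check_sign.
- by check_sign.
Qed.

End Parts.

(** * Graphs containing a pentagon *)

Section Pentagon.
Variable G : sgraph.
Hypothesis P6 : path_free 6 G.
Hypothesis no_part : ~ all_round_part G.

Lemma triangle_free (x y z : G) : adj x y -> adj y z -> adj x z = false.
Proof.
move=> xy yz; apply/negP; rewrite adj_sym => zx.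
exact: no_part (triangle_part xy yz zx).
Qed.

Definition pentagon (c1 c2 c3 c4 c5 : G) :=
  [/\ adj c1 c2, adj c2 c3, adj c3 c4, adj c4 c5 & adj c5 c1].

Lemma pentagon_rot c1 c2 c3 c4 c5 :
  pentagon c1 c2 c3 c4 c5 -> pentagon c2 c3 c4 c5 c1.
Proof. by case. Qed.

Lemma pentagon_rev c1 c2 c3 c4 c5 :
  pentagon c1 c2 c3 c4 c5 -> pentagon c1 c5 c4 c3 c2.
Proof. by case=> *; split; rewrite adj_sym. Qed.

(** If two nonconsecutive vertices coincided, the longer arc between them would close to a
    triangle. *)
Lemma pentagon_uniq c1 c2 c3 c4 c5 :
  pentagon c1 c2 c3 c4 c5 -> uniq [:: c1; c2; c3; c4; c5].
Proof.
have neq (x y z t : G) : adj y z -> adj z t -> adj t x -> x != y.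
  move=> yz zt tx; apply: contraTneq tx => ->.
  by rewrite adj_sym (triangle_free yz zt).
case=> a12 a23 a34 a45 a51; rewrite /= !inE !negb_or (adj_neq a12) (adj_neq a23) (adj_neq a34) (adj_neq a45).
rewrite (neq c1 c3 c4 c5) // [c1 == c4]eq_sym (neq c4 c1 c2 c3) // [c1 == c5]eq_sym.
by rewrite (adj_neq a51) (neq c2 c4 c5 c1) // [c2 == c5]eq_sym (neq c5 c2 c3 c4) //
  (neq c3 c5 c1 c2).
Qed.

(** Otherwise [v] closes a 4-cycle with [c1 c2 c3], and the rest of the pentagon is an odd ear on
    it. *)
Lemma pentagon_dist2 v c1 c2 c3 c4 c5 : pentagon c1 c2 c3 c4 c5 ->
  v \notin [:: c1; c2; c3; c4; c5] -> adj v c1 -> adj v c3 = false.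
Proof.
move=> pent vN vc1; apply/negP => vc3; apply: no_part.
case: (pent) => a12 a23 a34 a45 a51.
apply: (@square_part _ v c1 c2 c3 c4 c5) => //; rewrite 1?adj_sym //.
by rewrite cons_uniq vN pentagon_uniq.
Qed.

Lemma pentagon_nbr v c1 c2 c3 c4 c5 c : pentagon c1 c2 c3 c4 c5 ->
  v \notin [:: c1; c2; c3; c4; c5] -> adj v c1 -> c \in [:: c1; c2; c3; c4; c5] ->
  adj v c -> c = c1.
Proof.
move=> pent vN vc1; rewrite !inE; case: (pent) => a12 a23 a34 a45 a51.
case/or4P=> [/eqP->//|/eqP->|/eqP->|/orP[]/eqP->].
- by rewrite (triangle_free vc1 a12).
- by rewrite (pentagon_dist2 pent vN vc1).
- rewrite (pentagon_dist2 (pentagon_rev pent) _ vc1) //.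
  by move: vN; rewrite -[_ :: _]/(rcons [:: _; _; _; _] _) !inE /=; do ! case: eqP.
- by rewrite (triangle_free vc1) // adj_sym.
Qed.

Lemma pentagon_attached v1 v2 c1 c2 c3 c4 c5 : pentagon c1 c2 c3 c4 c5 ->
  v1 \notin [:: c1; c2; c3; c4; c5] -> v2 \notin [:: c1; c2; c3; c4; c5] ->
  adj v1 c1 -> adj v2 v1 -> False.
Proof.
(* The reflection fixing [c1] exchanges [c3] and [c4], so a neighbour of [v2] among them may be
   taken to be [c3]. *)
wlog nv23 : c2 c3 c4 c5 / adj v2 c3 || ~~ adj v2 c4 => [wl|].
  case: (boolP (adj v2 c4)) => v24 pent v1N v2N v11 v21.
    have rev v : (v \in [:: c1; c5; c4; c3; c2]) = (v \in [:: c1; c2; c3; c4; c5]).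
      by rewrite !inE; do ! case: eqP.
    by apply: (wl c5 c4 c3 c2) => //; rewrite ?v24 ?rev //; exact: pentagon_rev.
  by apply: (wl c2 c3 c4 c5) => //; rewrite v24 orbT.
move=> pent v1N v2N v11 v21; case: (pent) => a12 a23 a34 a45 a51.
case: (boolP (adj v2 c3)) => [v23|v23] in nv23 *.
  apply: no_part; apply: (@hexagon_part _ c1 c2 c3 c4 c5 v1 v2) => //; rewrite 1?adj_sym //.
  rewrite -[_ :: _]/([:: c1; c2; c3; c4; c5] ++ [:: v1; v2]) cat_uniq pentagon_uniq //=.
  by rewrite !orbF negb_or v1N v2N inE eq_sym (adj_neq v21).
move: nv23 => /= /negPf v24; have v2c1 : adj v2 c1 = false := triangle_free v21 v11.
have v1c c : c \in [:: c2; c3; c4; c5] -> adj v1 c = false.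
  move=> cc; apply/negP => v1c; have := pentagon_uniq pent; rewrite cons_uniq.
  by rewrite -(pentagon_nbr pent v1N v11 _ v1c) ?cc // inE cc orbT.
have a54 : adj c5 c4 by rewrite adj_sym.
have a43 : adj c4 c3 by rewrite adj_sym.
have a15 : adj c1 c5 by rewrite adj_sym.
(* Now [v2] can only be adjacent to [c2] or [c5], and not to both. Going round the pentagon on the
   side that avoids the neighbour, [v2 v1 c1 c2 c3 c4] or [v2 v1 c1 c5 c4 c3] is an induced path. *)
case: (boolP (adj v2 c5)) => v2c5.
  have v2c2 : adj v2 c2 = false.
    apply: (@pentagon_dist2 v2 c5 c1 c2 c3 c4) v2c5 => //.
    by rewrite -(mem_rot 1).
  have := path6_chord P6 v21 v11 a12 a23 a34.
  rewrite v2c1 v2c2 (negPf v23) v24 !v1c ?inE ?eqxx ?orbT //.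
  rewrite (triangle_free a12 a23) (triangle_free a23 a34) /= orbF.
  by rewrite adj_sym (triangle_free a45 a51).
have := path6_chord P6 v21 v11 a15 a54 a43.
rewrite v2c1 (negPf v2c5) (negPf v23) v24 !v1c ?inE ?eqxx ?orbT //.
rewrite (triangle_free a15 a54) (triangle_free a54 a43) /= orbF.
by rewrite (triangle_free a12 a23).
Qed.

(** Deleting the edge from [v] to [c1] leaves [v] another neighbour [u], which can lie neither on
    the pentagon nor off it. *)
Lemma pentagon_dominates v c1 c2 c3 c4 c5 :
  two_edge_connected G -> pentagon c1 c2 c3 c4 c5 ->
  v \notin [:: c1; c2; c3; c4; c5] -> adj v c1 -> False.
Proof.
move=> [_ conD] pent vN vc1.
have [_ /(_ v c1)/connectP[[|u p] /=]] :=
  conD (exist (fun s => s \in edge_set G) [set v; c1] (edge_set2 vc1)).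
  by move=> _ c1v; rewrite c1v adj_irr in vc1.
case/andP=> /andP[vu uc1] _ _.
case: (boolP (u \in [:: c1; c2; c3; c4; c5])) => [uC|uN].
  by rewrite (pentagon_nbr pent vN vc1 uC vu) eqxx in uc1.
by apply: pentagon_attached pent vN uN vc1 _; rewrite adj_sym.
Qed.

Lemma pentagon_cycle5 c1 c2 c3 c4 c5 :
  two_edge_connected G -> pentagon c1 c2 c3 c4 c5 -> isomorphic G (cycle_graph 5).
Proof.
move=> G2 pent; set C := [:: c1; c2; c3; c4; c5].
have CT v : v \in C.
  apply: contraT => vN; case: (G2) => -[_ conG] _.
  have c1C : c1 \in [set x in C] by rewrite !inE eqxx.
  have [|u [y [uy uC yN]]] := connect_exit (conG c1 v) c1C; first by rewrite inE.
  have yc : adj y u by rewrite adj_sym.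
  (* A rotation of the pentagon puts the attachment vertex [u] first. *)
  move: yN uC; rewrite !inE => yN /or4P[/eqP E|/eqP E|/eqP E|/orP[]/eqP E];
    rewrite {u uy}E in yc.
  - by case: (pentagon_dominates G2 pent _ yc); rewrite !inE.
  - by case: (pentagon_dominates G2 (pentagon_rot pent) _ yc);
      rewrite -(mem_rot 4) !inE.
  - by case: (pentagon_dominates G2 (pentagon_rot (pentagon_rot pent)) _ yc);
      rewrite -(mem_rot 3) !inE.
  - by case: (pentagon_dominates G2 (pentagon_rot (pentagon_rot (pentagon_rot pent))) _ yc);
      rewrite -(mem_rot 2) !inE.
  - by case: (pentagon_dominates G2 
      (pentagon_rot (pentagon_rot (pentagon_rot (pentagon_rot pent)))) _ yc);
      rewrite -(mem_rot 1) !inE.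
have uC : uniq C := pentagon_uniq pent.
pose g (i : 'I_5) := nth c1 C i; pose h v : 'I_5 := inord (index v C).
have idx v : (index v C < 5)%N by rewrite -[5%N]/(size C) index_mem.
have hK : cancel h g by move=> v; rewrite /g inordK // nth_index.
have gK : cancel g h.
  by move=> i; apply: val_inj; rewrite /= inordK // index_uniq ?ltn_ord.
case: (pent) => a12 a23 a34 a45 a51.
have gE i j : adj (g i) (g j) = cycle_adj i j.
  wlog ij : i j / (i < j)%N => [wl|].
    case: (ltngtP i j) => [/wl//|/wl|/val_inj->]; last by rewrite adj_irr cycle_adj_irr.
    by rewrite adj_sym cycle_adj_sym.
  move: i j ij => [[|[|[|[|[|//]]]]] ?] [[|[|[|[|[|//]]]]] ?] //= _; rewrite /g /C /=.
  - by rewrite (triangle_free a12 a23).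
  - by rewrite adj_sym (triangle_free a45 a51).
  - by rewrite adj_sym a51.
  - by rewrite (triangle_free a23 a34).
  - by rewrite adj_sym (triangle_free a51 a12).
  - by rewrite (triangle_free a34 a45).
exists h => [|x y]; first by exists g.
by rewrite -[x in RHS]hK -[y in RHS]hK gE.
Qed.

End Pentagon.

Theorem theorem4p8 (G : sgraph) :
  two_edge_connected G -> path_free 6 G -> ~ isomorphic G (cycle_graph 5) ->
  all_round G \/ bipartite_all_round G.
Proof.
move=> G2 P6 nC5; case: (classic (all_round_part G)) => [[S [x [xS sol]]]|no_part].
  left; apply: (solvable_all_round x); apply: (solvable_grow G2 P6 _ xS sol).
  by move=> u v _; apply/eqP.
case: (G2) => -[/card_gt0P[r _] conG] _; right.
(* A pentagon would make [G] the excluded cycle, so level parity is a proper 2-colouring. *)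
have cP : forall u v : G, adj u v -> odd (level r conG u) != odd (level r conG v).
  apply: level_coloring => // [x y z|v1 v2 v3 v4 v5 a12 a23 a34 a45].
    exact: triangle_free.
  apply/negP => a51; apply: nC5; apply: (@pentagon_cycle5 _ _ _ v1 v2 v3 v4 v5) => //.
apply: (solvable_bipartite_all_round r cP).
apply: (solvable_grow G2 P6 _ (set11 r)); last exact: solvable1 (sign_sqr _ r).
move=> u v /cP; rewrite /sign; case: odd; case: odd => // _.
by rewrite opprK.
Qed.
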